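(* Let $R$ be a maximal subring of a ring $T$. Assume that $T$ has a nonzero ideal $I$ such that $R\cap I=0$. Then the following hold: (1) $I$ is a minimal ideal of $T$. Moreover, $I$ is maximal (among ideals of $T$) with respect to the property $R\cap I=0$. (2) $(R:T)_l=r.ann_R(I)$ and $(R:T)_r=l.ann_R(I)$. (3) If $I^2\neq 0$ (in particular, if $T$ is semiprime), then $(R:T)=(R:T)_l=(R:T)_r$. (4) $T$ is a semiprime ring if and only if $R$ is semiprime and $I^2\neq 0$. In particular, in this case $Q:=ann_T(I)$ is a minimal prime ideal of $T$ and $Q\cap R=(R:T)=(R:T)_l=(R:T)_r$. (5) If $I^2=0$, then for every prime (resp. semiprime, maximal, left primitive, right primitive, strongly prime) ideal $Q$ of $T$, the contraction $Q\cap R$ is a prime (resp. semiprime, maximal, left primitive, right primitive, strongly prime) ideal of $R$. In particular, $J(R)\subseteq J(T)\cap R$, $Nil_*(R)\subseteq Nil_*(T)\cap R$ and $Nil^*(R)\subseteq Nil^*(T)\cap R$. Moreover, $U(T)=U(R)+I$. (6) For each left (resp. right) ideal $A$ of $R$, $TA\cap R=A$ (resp. $AT\cap R=A$). (7) If $I^2=I$, then for each ideal $A$ of $R$ either $A\subseteq (R:T)$, or $IA=AI=I$ and $AT=TA$.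
   Context: All rings are associative and unital (not necessarily commutative), and subrings contain the identity of the big ring; ''ideal'' means two-sided ideal. A maximal subring $R$ of $T$ is a proper subring with no subring strictly between $R$ and $T$. Conductors: $(R:T)=\{x\in T: TxT\subseteq R\}$, $(R:T)_l=\{x\in T: Tx\subseteq R\}$, $(R:T)_r=\{x\in T: xT\subseteq R\}$ (the largest ideal, left ideal, right ideal of $T$ contained in $R$, respectively). $l.ann_R(I)=\{r\in R: rI=0\}$, $r.ann_R(I)=\{r\in R: Ir=0\}$, $ann_T(I)=\{t\in T: tI=It=0\}$. $J$ is the Jacobson radical, $Nil_*$ the lower nilradical (intersection of all prime ideals), $Nil^*$ the upper nilradical (the largest nil ideal), $U$ the group of units. An ideal $P$ of $T$ is strongly prime if $T/P$ is a prime ring with no nonzero nil ideals. A minimal ideal is a minimal nonzero ideal. *)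

(* Defs.v *)
From HB Require Import structures.
From mathcomp Require Import all_boot all_algebra generic_quotient ring_quotient.
From mathcomp Require Import boolp classical_sets.

Set Implicit Arguments.
Unset Strict Implicit.
Unset Printing Implicit Defensive.

Import GRing.Theory.
Local Open Scope ring_scope.
Local Open Scope classical_set_scope.
Local Open Scope quotient_scope.

(* Rings are [pzRingType]s (associative, unital, not necessarily commutative),
   and ideals, radicals, conductors, ... are subsets in the sense of [set].  A
   subring of [T] is a ring [R : subPzRingType S] whose image under the
   morphism [\val : R -> T] is [S : {pred T}]. *)

(* Closure under opposites is multiplication by -1. *)
Definition left_ideal (A : pzRingType) (L : set A) : Prop :=
  [/\ L 0, forall x y, L x -> L y -> L (x + y)
    & forall a x, L x -> L (a * x)].

Definition right_ideal (A : pzRingType) (L : set A) : Prop :=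
  [/\ L 0, forall x y, L x -> L y -> L (x + y)
    & forall a x, L x -> L (x * a)].

Definition ideal (A : pzRingType) (P : set A) : Prop :=
  left_ideal P /\ right_ideal P.

(* The product of two subsets: the finite sums of products x * y. *)
Definition prodset (A : pzRingType) (X Y : set A) : set A :=
  [set z | exists s : seq (A * A),
     (forall p, p \in s -> X p.1 /\ Y p.2) /\ z = \sum_(p <- s) p.1 * p.2].

Definition proper_set (A : Type) (P : set A) : Prop := P <> setT.

Definition prime_ideal (A : pzRingType) (P : set A) : Prop :=
  [/\ ideal P, proper_set P
    & forall X Y : set A, ideal X -> ideal Y ->
        prodset X Y `<=` P -> X `<=` P \/ Y `<=` P].

(* The whole ring counts as a semiprime ideal. *)
Definition semiprime_ideal (A : pzRingType) (P : set A) : Prop :=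
  ideal P /\ forall X : set A, ideal X -> prodset X X `<=` P -> X `<=` P.

Definition prime_ring (A : pzRingType) : Prop := prime_ideal [set (0 : A)].

Definition semiprime_ring (A : pzRingType) : Prop :=
  semiprime_ideal [set (0 : A)].

Definition maximal_ideal (A : pzRingType) (P : set A) : Prop :=
  [/\ ideal P, proper_set P
    & forall X : set A, ideal X -> P `<=` X -> X = P \/ X = setT].

Definition maximal_left_ideal (A : pzRingType) (L : set A) : Prop :=
  [/\ left_ideal L, proper_set L
    & forall X : set A, left_ideal X -> L `<=` X -> X = L \/ X = setT].

Definition minimal_ideal (A : pzRingType) (P : set A) : Prop :=
  [/\ ideal P, P <> [set 0]
    & forall X : set A, ideal X -> X <> [set 0] -> X `<=` P -> X = P].

Definition minimal_prime_ideal (A : pzRingType) (P : set A) : Prop :=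
  prime_ideal P /\ forall X : set A, prime_ideal X -> X `<=` P -> X = P.

Definition simple_module (A : pzRingType) (M : lmodType A) : Prop :=
  (exists m : M, m != 0) /\
  forall N : {pred M}, GRing.submod_closed N -> N =i pred1 0 \/ N =i predT.

Definition left_primitive_ideal (A : pzRingType) (P : set A) : Prop :=
  exists M : lmodType A,
    simple_module M /\ P = [set a | forall m : M, a *: m = 0].

(* A right A-module is a left module over the converse ring A^c. *)
Definition right_primitive_ideal (A : pzRingType) (P : set A) : Prop :=
  @left_primitive_ideal A^c P.

Definition nil_set (A : pzRingType) (N : set A) : Prop :=
  forall x, N x -> exists n : nat, x ^+ n = 0.

(* The library's additive quotient {quot I} is made into a ring only when the
   ambient ring is commutative. *)
Section QuotientRing.
Variables (A : pzRingType) (P : set A) (hP : ideal P).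

Definition ideal_pred of ideal P : {pred A} := [pred x | `[< P x >]].

Fact ideal_pred_zmod_closed : zmod_closed (ideal_pred hP).
Proof.
have [[P0 PD PM] _] := hP; split; first exact/asboolP.
move=> x y /asboolP Px /asboolP Py; apply/asboolP.
by rewrite -mulN1r; apply: PD => //; apply: PM.
Qed.

HB.instance Definition _ :=
  GRing.isZmodClosed.Build A (ideal_pred hP) ideal_pred_zmod_closed.

Definition quot_ring : Type := Quotient.quot (ideal_pred hP : zmodClosed A).

HB.instance Definition _ := GRing.Zmodule.on quot_ring.
HB.instance Definition _ := Quotient.on quot_ring.

Definition quot_proj (x : A) : quot_ring := \pi_quot_ring x.

Lemma quot_projE x y : quot_proj x = quot_proj y <-> P (x - y).
Proof.
split=> [/eqP|Pxy].
  by rewrite /quot_proj -Quotient.idealrBE => /asboolP.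
by apply/eqP; rewrite /quot_proj -Quotient.idealrBE; apply/asboolP.
Qed.

Lemma quot_proj_surj y : exists x, quot_proj x = y.
Proof. by exists (repr y); rewrite /quot_proj reprK. Qed.

Lemma quot_proj_repr y : quot_proj (repr y) = y.
Proof. exact: reprK. Qed.

Fact quot_projB : zmod_morphism quot_proj.
Proof. by move=> x y; rewrite /quot_proj !piE. Qed.

Definition quot_one : quot_ring := quot_proj 1.
Definition quot_mul (x y : quot_ring) : quot_ring :=
  quot_proj (repr x * repr y).

Lemma quot_projM x y :
  quot_proj (x * y) = quot_mul (quot_proj x) (quot_proj y).
Proof.
have [[_ PD PMl] [_ _ PMr]] := hP.
set x' := repr (quot_proj x); set y' := repr (quot_proj y).
have Px : P (x - x') by apply/quot_projE; rewrite quot_proj_repr.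
have Py : P (y - y') by apply/quot_projE; rewrite quot_proj_repr.
apply/quot_projE; rewrite -/x' -/y'.
have -> : x * y - x' * y' = (x - x') * y + x' * (y - y').
  by rewrite mulrBl mulrBr addrA subrK.
by apply: PD; [apply: PMr | apply: PMl].
Qed.

Fact quot_mulA : associative quot_mul.
Proof.
by move=> x y z; rewrite -[x]quot_proj_repr -[y]quot_proj_repr
  -[z]quot_proj_repr -!quot_projM mulrA.
Qed.

Fact quot_mul1x : left_id quot_one quot_mul.
Proof. by move=> x; rewrite -[x]quot_proj_repr -quot_projM mul1r. Qed.

Fact quot_mulx1 : right_id quot_one quot_mul.
Proof. by move=> x; rewrite -[x]quot_proj_repr -quot_projM mulr1. Qed.

Fact quot_projD x y : quot_proj (x + y) = quot_proj x + quot_proj y.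
Proof. by rewrite /quot_proj !piE. Qed.

Fact quot_mulDl : left_distributive quot_mul +%R.
Proof.
by move=> x y z; rewrite -[x]quot_proj_repr -[y]quot_proj_repr
  -[z]quot_proj_repr -!(quot_projD, quot_projM) mulrDl.
Qed.

Fact quot_mulDr : right_distributive quot_mul +%R.
Proof.
by move=> x y z; rewrite -[x]quot_proj_repr -[y]quot_proj_repr
  -[z]quot_proj_repr -!(quot_projD, quot_projM) mulrDr.
Qed.

HB.instance Definition _ := GRing.Zmodule_isPzRing.Build quot_ring
  quot_mulA quot_mul1x quot_mulx1 quot_mulDl quot_mulDr.

HB.instance Definition _ :=
  GRing.isZmodMorphism.Build A quot_ring quot_proj quot_projB.

Fact quot_proj_monoid : monoid_morphism quot_proj.
Proof. by split=> // x y; apply: quot_projM. Qed.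

HB.instance Definition _ :=
  GRing.isMonoidMorphism.Build A quot_ring quot_proj quot_proj_monoid.

End QuotientRing.

Definition strongly_prime_ideal (A : pzRingType) (P : set A) : Prop :=
  exists hP : ideal P, prime_ring (quot_ring hP) /\
    forall N : set (quot_ring hP), ideal N -> nil_set N -> N = [set 0].

Definition jacobson_radical (A : pzRingType) : set A :=
  [set x | forall L : set A, maximal_left_ideal L -> L x].

Definition lower_nilradical (A : pzRingType) : set A :=
  [set x | forall P : set A, prime_ideal P -> P x].

(* The union of all nil ideals; see [upper_nilradicalP]. *)
Definition upper_nilradical (A : pzRingType) : set A :=
  [set x | exists N : set A, [/\ ideal N, nil_set N & N x]].

Lemma upper_nilradicalP (A : pzRingType) :
  [/\ ideal (@upper_nilradical A), nil_set (@upper_nilradical A)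
    & forall N : set A, ideal N -> nil_set N -> N `<=` @upper_nilradical A].
Proof.
have UD (x y : A) : upper_nilradical x -> upper_nilradical y ->
    upper_nilradical (x + y).
  move=> [N [[[N0 ND NL] [_ _ NR]] nN Nx]] [M [[[M0 MD ML] [_ _ MR]] nM My]].
  exists [set z | exists u v, [/\ N u, M v & z = u + v]]; split; last first.
  - by exists x, y.
  - move=> _ [u [v [Nu Mv ->]]].
    have [n un] := nN _ Nu.
    have [w Mw uvE] : exists2 w, M w & (u + v) ^+ n = u ^+ n + w.
      elim: n {un} => [|n [w Mw IHn]]; first by exists 0; rewrite ?addr0.
      exists (u * w + v * (u ^+ n + w)).
        by apply: MD; [apply: ML | apply: MR].
      by rewrite exprS IHn mulrDl mulrDr -exprS addrA.
    have [m wm] := nM _ Mw.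
    by exists (n * m)%N; rewrite exprM uvE un add0r.
  - by split; split; [exists 0, 0; rewrite addr0
      | move=> _ _ [u [v [Nu Mv ->]]] [u' [v' [Nu' Mv' ->]]];
        exists (u + u'), (v + v'); rewrite addrACA; split=> //; auto
      | move=> a _ [u [v [Nu Mv ->]]];
        do [exists (a * u), (a * v) | exists (u * a), (v * a)];
        rewrite (mulrDl, mulrDr); split; auto
      | exists 0, 0; rewrite addr0
      | move=> _ _ [u [v [Nu Mv ->]]] [u' [v' [Nu' Mv' ->]]];
        exists (u + u'), (v + v'); rewrite addrACA; split=> //; auto
      | move=> a _ [u [v [Nu Mv ->]]]; exists (u * a), (v * a);
        rewrite mulrDl; split; auto].
have U0 : upper_nilradical (0 : A).
  exists [set 0]; split=> //; last by move=> _ ->; exists 1.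
  by split; split=> // [_ _ -> ->|a _ ->]; rewrite ?addr0 ?mulr0 ?mul0r.
split=> [||N iN nN x Nx]; last by exists N.
- split; split=> // a x [N [[[N0 ND NL] [_ _ NR]] nN Nx]];
    exists N; split=> //; by [apply: NL | apply: NR].
- by move=> x [N [_ nN Nx]]; apply: nN.
Qed.

Definition unit_set (A : pzRingType) : set A :=
  [set x | exists y, x * y = 1 /\ y * x = 1].

Definition maximal_subring (T : pzRingType) (S : {pred T}) : Prop :=
  [/\ GRing.subring_closed S, exists x, x \notin S
    & forall S' : {pred T}, GRing.subring_closed S' -> {subset S <= S'} ->
        S' =i S \/ S' =i predT].

Definition conductor (T : pzRingType) (S : {pred T}) : set T :=
  [set x | forall s t, s * x * t \in S].

Definition left_conductor (T : pzRingType) (S : {pred T}) : set T :=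
  [set x | forall t, t * x \in S].

Definition right_conductor (T : pzRingType) (S : {pred T}) : set T :=
  [set x | forall t, x * t \in S].

Definition lann_in (T : pzRingType) (S : {pred T}) (I : set T) : set T :=
  [set r | r \in S /\ forall i, I i -> r * i = 0].

Definition rann_in (T : pzRingType) (S : {pred T}) (I : set T) : set T :=
  [set r | r \in S /\ forall i, I i -> i * r = 0].

Definition ann (T : pzRingType) (I : set T) : set T :=
  [set t | forall i, I i -> t * i = 0 /\ i * t = 0].

(* Main.v *)
Require Import Defs.
From HB Require Import structures.
From mathcomp Require Import all_boot all_algebra.
From mathcomp Require Import boolp classical_sets.

(* Maximality of R gives T = R + L for every multiplicatively closed
   (R, R)-subbimodule L of T not contained in R.  Since R meets I in 0, this
   makes T = R + I a direct sum, and every multiplicatively closed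
   (R, R)-subbimodule of I is 0 or I.  Applied to the ideals of T inside I, to
   the annihilators of I in I, and to IA and AI for an ideal A of R, this gives
   everything except (5).  If I^2 = 0, then I is contained in every semiprime,
   maximal or left primitive ideal Q of T, so R / (Q meet R) is isomorphic to
   T / Q and the properties of Q descend to its contraction. *)

Set Implicit Arguments.
Unset Strict Implicit.
Unset Printing Implicit Defensive.

Import GRing.Theory.
Local Open Scope ring_scope.
Local Open Scope classical_set_scope.

(** * Ideals, their products, and elementwise criteria for primeness *)

Section Ideals.
Variable A : pzRingType.
Implicit Types (P X Y : set A).

Lemma left_idealN P x : left_ideal P -> P x -> P (- x).
Proof. by move=> [_ _ PM] Px; rewrite -mulN1r; apply: PM. Qed.

Lemma left_idealB P x y : left_ideal P -> P x -> P y -> P (x - y).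
Proof.
by move=> iP Px Py; have [_ PD _] := iP; apply: PD => //; apply: left_idealN.
Qed.

Lemma left_idealDr P x y : left_ideal P -> P x -> P (x + y) -> P y.
Proof.
by move=> iP Px Pxy; rewrite -[y](addKr x) addrC; apply: left_idealB.
Qed.

Lemma left_idealBr P x y : left_ideal P -> P (x - y) -> P y -> P x.
Proof. by move=> [_ PD _] Pxy Py; rewrite -[x](subrK y); apply: PD. Qed.

Lemma left_ideal1 P : left_ideal P -> P 1 -> P = setT.
Proof.
move=> [_ _ PM] P1; apply/seteqP; split=> // x _.
by rewrite -[x]mulr1; apply: PM.
Qed.

Lemma ideal0 : ideal [set (0 : A)].
Proof.
by split; split=> // [_ _ -> ->|a _ ->]; rewrite ?addr0 ?mulr0 ?mul0r.
Qed.

Lemma ideal_expr_cong P x y n : ideal P -> P (x - y) -> P (x ^+ n - y ^+ n).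
Proof.
move=> [[P0 PD PL] [_ _ PR]] Pxy; elim: n => [|n IHn].
  by rewrite subrr.
have -> : x ^+ n.+1 - y ^+ n.+1 = (x - y) * x ^+ n + y * (x ^+ n - y ^+ n).
  by rewrite mulrBl mulrBr -!exprS addrA subrK.
by apply: PD; [apply: PR | apply: PL].
Qed.

Lemma prodset_mul X Y x y : X x -> Y y -> prodset X Y (x * y).
Proof.
move=> Xx Yy; exists [:: (x, y)]; split; last by rewrite big_seq1.
by move=> p; rewrite inE => /eqP ->.
Qed.

Lemma prodset0 X Y : prodset X Y 0.
Proof. by exists [::]; split=> //; rewrite big_nil. Qed.

Lemma prodsetD X Y x y : prodset X Y x -> prodset X Y y -> prodset X Y (x + y).
Proof.
move=> [s [hs ->]] [t [ht ->]]; exists (s ++ t); rewrite big_cat; split=> // p.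
by rewrite mem_cat => /orP[/hs|/ht].
Qed.

(** Acts as the induction principle for [prodset]: [P] is taken to be the set of elements with the
    property to be proved, and need only be an additive submonoid. *)
Lemma prodset_sub X Y P : P 0 -> (forall x y, P x -> P y -> P (x + y)) ->
  (forall x y, X x -> Y y -> P (x * y)) -> prodset X Y `<=` P.
Proof.
move=> P0 PD PM _ [s [hs ->]]; rewrite big_seq.
by apply: big_ind => // p /hs[]; apply: PM.
Qed.

Lemma prodset_mull X Y a z : (forall x, X x -> X (a * x)) ->
  prodset X Y z -> prodset X Y (a * z).
Proof.
move=> Xa; suff H : prodset X Y `<=` [set u | prodset X Y (a * u)] by apply: H.
apply: prodset_sub => /=; first by rewrite mulr0; apply: prodset0.
  by move=> x y; rewrite mulrDr; apply: prodsetD.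
by move=> x y Xx Yy; rewrite mulrA; apply: prodset_mul => //; apply: Xa.
Qed.

Lemma prodset_mulr X Y a z : (forall y, Y y -> Y (y * a)) ->
  prodset X Y z -> prodset X Y (z * a).
Proof.
move=> Ya; suff H : prodset X Y `<=` [set u | prodset X Y (u * a)] by apply: H.
apply: prodset_sub => /=; first by rewrite mul0r; apply: prodset0.
  by move=> x y; rewrite mulrDl; apply: prodsetD.
by move=> x y Xx Yy; rewrite -mulrA; apply: prodset_mul => //; apply: Ya.
Qed.

Lemma prodset_eq0 X Y :
  prodset X Y = [set 0] <-> forall x y, X x -> Y y -> x * y = 0.
Proof.
split=> [XY0 x y Xx Yy|XY0].
  by have := prodset_mul Xx Yy; rewrite XY0.
apply/seteqP; split=> [|_ ->]; last exact: prodset0.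
by apply: prodset_sub => // _ _ -> ->; apply: addr0.
Qed.

(* The ideals [Y = {y | a A y <= P}] and [X = {x | x A Y <= P}] contain [b] and
   [a] respectively, and [X Y <= P]. *)
Lemma prime_idealP P : prime_ideal P <->
  [/\ ideal P, proper_set P
    & forall a b, (forall r, P (a * r * b)) -> P a \/ P b].
Proof.
split=> [[iP pP prP]|[iP pP prP]]; split=> //; have [[P0 PD PL] [_ _ PR]] := iP.
  move=> a b Pab.
  set Y := [set y | forall r, P (a * r * y)].
  set X := [set x | forall r y, Y y -> P (x * r * y)].
  have iY : ideal Y.
    split; split=> [r|x y Yx Yy r|c x Yx r]; rewrite ?mulr0 ?mulrDr ?mulrA //.
    - exact: PD.
    - by rewrite -(mulrA a).
    - exact: PD.
    - exact: PR.
  have iX : ideal X.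
    split; split=> [r z _|x y Xx Xy r z Yz|c x Xx r z Yz];
      rewrite ?mul0r ?mulrDl //.
    - by apply: PD; [apply: Xx | apply: Xy].
    - by rewrite -!mulrA; apply: PL; rewrite mulrA; apply: Xx.
    - by apply: PD; [apply: Xx | apply: Xy].
    - by rewrite -(mulrA x); apply: Xx.
  have [|H|H] := prP _ _ iX iY.
  - by apply: prodset_sub => // x y Xx Yy; rewrite -[x]mulr1; apply: Xx.
  - by left; apply: H => r y; apply.
  - by right; apply: H => r; apply: Pab.
move=> X Y iX iY XYP.
have [XP|/existsNP[x /not_implyP[Xx nPx]]] := pselect (X `<=` P); first by left.
right=> y Yy; have [] // := prP x y => r; apply: XYP.
by apply: prodset_mul => //; have [_ [_ _ XR]] := iX; apply: XR.
Qed.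

(** The two ideals are those of the prime case with [b = a]; now [a] lies in both, and the square of
    their intersection lies in [P]. *)
Lemma semiprime_idealP P : semiprime_ideal P <->
  ideal P /\ forall a, (forall r, P (a * r * a)) -> P a.
Proof.
split=> [[iP prP]|[iP prP]]; split=> //; have [[P0 PD PL] [_ _ PR]] := iP.
  move=> a Pa.
  set Y := [set y | forall r, P (a * r * y)].
  set X := [set x | forall r y, Y y -> P (x * r * y)].
  have iXY : ideal (X `&` Y).
    split; split=> [|x y [Xx Yx] [Xy Yy]|c x [Xx Yx]].
    - by split=> [r z _|r]; rewrite ?mul0r ?mulr0.
    - split=> [r z Yz|r]; rewrite ?mulrDl ?mulrDr; apply: PD => //;
        by [apply: Xx | apply: Xy].
    - split=> [r z Yz|r]; last by rewrite mulrA -(mulrA a); apply: Yx.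
      by rewrite -!mulrA; apply: PL; rewrite mulrA; apply: Xx.
    - by split=> [r z Yz|r]; rewrite ?mul0r ?mulr0.
    - split=> [r z Yz|r]; rewrite ?mulrDl ?mulrDr; apply: PD => //;
        by [apply: Xx | apply: Xy].
    - split=> [r z Yz|r]; last by rewrite mulrA; apply: PR.
      by rewrite -(mulrA x); apply: Xx.
  apply: (prP _ iXY); last by split=> [r y|r]; [apply | apply: Pa].
  apply: prodset_sub => // x y [Xx _] [_ Yy].
  by rewrite -[x]mulr1; apply: Xx.
move=> X iX XXP x Xx; apply: prP => r; apply: XXP.
by apply: prodset_mul => //; have [_ [_ _ XR]] := iX; apply: XR.
Qed.

Lemma prime_semiprime_ideal P : prime_ideal P -> semiprime_ideal P.
Proof.
by move=> [iP _ prP]; split=> // X iX XXP; case: (prP X X iX iX XXP).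
Qed.

Lemma square_zero_sub_semiprime X P : ideal X ->
  (forall x y, X x -> X y -> x * y = 0) -> semiprime_ideal P -> X `<=` P.
Proof.
move=> [[X0 _ _] [_ _ XR]] X2 /semiprime_idealP[[[P0 _ _] _] prP] x Xx.
by apply: prP => r; rewrite X2 //; apply: XR.
Qed.

(** If [X + L] were the whole ring, then [1 = x + l], so [x = x * x + x * l = x * l] would lie in
    [L], and [1] with it. *)
Lemma square_zero_sub_maximal_left X L : ideal X ->
  (forall x y, X x -> X y -> x * y = 0) -> maximal_left_ideal L -> X `<=` L.
Proof.
move=> [[X0 XD XL] _] X2 [lL pL mL].
have [L0 LD LM] := lL.
set Y := [set z | exists x l, [/\ X x, L l & z = x + l]].
have lY : left_ideal Y.
  split; first by exists 0, 0; rewrite addr0.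
    move=> _ _ [x [l [Xx Ll ->]]] [x' [l' [Xx' Ll' ->]]].
    by exists (x + x'), (l + l'); rewrite addrACA; split; auto.
  move=> a _ [x [l [Xx Ll ->]]].
  by exists (a * x), (a * l); rewrite mulrDr; split; auto.
have LY : L `<=` Y by move=> l Ll; exists 0, l; rewrite add0r.
have [YL|YT] := mL _ lY LY.
  by move=> x Xx; rewrite -YL; exists x, 0; rewrite addr0.
have : Y 1 by rewrite YT.
move=> [x [l [Xx Ll E]]]; case: pL; apply: left_ideal1 => //.
rewrite E; apply: LD => //.
by rewrite -[x]mulr1 E mulrDr X2 // add0r; apply: LM.
Qed.

Lemma square_zero_sub_maximal X P : ideal X ->
  (forall x y, X x -> X y -> x * y = 0) -> maximal_ideal P -> X `<=` P.
Proof.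
move=> [[X0 XD XL] [_ _ XR]] X2 [iP pP mP].
have [[P0 PD PL] [_ _ PR]] := iP.
set Y := [set z | exists x l, [/\ X x, P l & z = x + l]].
have iY : ideal Y.
  have YD x y : Y x -> Y y -> Y (x + y).
    move=> [u [l [Xx Ll ->]]] [x' [l' [Xx' Ll' ->]]].
    by exists (u + x'), (l + l'); rewrite addrACA; split; auto.
  have Y0 : Y 0 by exists 0, 0; rewrite addr0.
  split; split=> // a _ [x [l [Xx Ll ->]]].
    by exists (a * x), (a * l); rewrite mulrDr; split; auto.
  by exists (x * a), (l * a); rewrite mulrDl; split; auto.
have PY : P `<=` Y by move=> l Ll; exists 0, l; rewrite add0r.
have [YP|YT] := mP _ iY PY.
  by move=> x Xx; rewrite -YP; exists x, 0; rewrite addr0.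
have : Y 1 by rewrite YT.
move=> [x [l [Xx Ll E]]]; case: pP; apply: left_ideal1; first by case: iP.
rewrite E; apply: PD => //.
by rewrite -[x]mulr1 E mulrDr X2 // add0r; apply: PL.
Qed.

End Ideals.

(* [B = f A + J], so for every ideal [Q] containing [J] the map [A -> B / Q]
   induced by [f] is onto, with kernel the contraction of [Q]. *)
Section SurjectiveModulo.
Variables (A B : pzRingType) (f : {rmorphism A -> B}) (J : set B).
Hypotheses (iJ : ideal J) (fJ : forall b, exists a, J (b - f a)).
Implicit Types (X : set A) (Q : set B).

(** This is [f X + J], the preimage in [B] of the image of [X] in [B / J]. *)
Definition extension X : set B := [set b | exists2 a, X a & J (b - f a)].

Lemma extension_left_ideal X : left_ideal X -> left_ideal (extension X).
Proof.
have [[J0 JD JL] [_ _ JR]] := iJ; move=> [X0 XD XL]; split.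
- by exists 0; rewrite // rmorph0 subr0.
- move=> x y [a Xa xa] [b Xb yb]; exists (a + b); first exact: XD.
  by rewrite rmorphD opprD addrACA; apply: JD.
- move=> b y [a Xa ya]; have [c bc] := fJ b; exists (c * a); first exact: XL.
  have -> : b * y - f (c * a) = b * (y - f a) + (b - f c) * f a.
    by rewrite rmorphM mulrBl mulrBr addrA subrK.
  by apply: JD; [apply: JL | apply: JR].
Qed.

Lemma extension_ideal X : ideal X -> ideal (extension X).
Proof.
have [[J0 JD JL] [_ _ JR]] := iJ.
move=> [lX [X0 XD XR]]; have lE := extension_left_ideal lX.
have [E0 ED _] := lE; split=> //; split=> // b y [a Xa ya].
have [c bc] := fJ b; exists (a * c); first exact: XR.
have -> : y * b - f (a * c) = (y - f a) * b + f a * (b - f c).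
  by rewrite rmorphM mulrBl mulrBr addrA subrK.
by apply: JD; [apply: JR | apply: JL].
Qed.

Lemma extension_mem X a : X a -> extension X (f a).
Proof. by move=> Xa; exists a; rewrite // subrr; case: iJ; case. Qed.

Lemma contraction_left_ideal Q : left_ideal Q -> left_ideal (f @^-1` Q).
Proof.
move=> [Q0 QD QL]; split; rewrite /preimage /= ?rmorph0 //.
  by move=> x y Qx Qy; rewrite rmorphD; apply: QD.
by move=> a x Qx; rewrite rmorphM; apply: QL.
Qed.

Lemma contraction_ideal Q : ideal Q -> ideal (f @^-1` Q).
Proof.
move=> [lQ [Q0 QD QR]]; split; first exact: contraction_left_ideal.
have [] := contraction_left_ideal lQ; split=> // a x; rewrite /preimage /=.
by move=> Qx; rewrite rmorphM; apply: QR.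
Qed.

Lemma contraction_proper Q : left_ideal Q ->
  proper_set Q <-> proper_set (f @^-1` Q).
Proof.
move=> lQ; split=> nQ E; apply: nQ; last by rewrite E.
apply: left_ideal1 => //; have : (f @^-1` Q) 1 by rewrite E.
by rewrite /preimage /= rmorph1.
Qed.

(** Modulo [J], hence modulo [Q], each element of [B] can be replaced by a value of [f]. Both
    directions serve later, for projections onto quotient rings. *)
Lemma contraction_prime Q : ideal Q -> J `<=` Q ->
  prime_ideal Q <-> prime_ideal (f @^-1` Q).
Proof.
move=> iQ JQ; have [lQ [Q0 QD QR]] := iQ; have [_ _ QL] := lQ.
have pQ := contraction_proper lQ.
rewrite !prime_idealP; split=> -[_ /pQ pP prQ]; split=> //.
- exact: contraction_ideal.
- move=> a b Qab; apply: prQ => r; have [c rc] := fJ r.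
  apply: (@left_idealBr _ _ _ (f (a * c * b))) => //; last exact: Qab.
  rewrite !rmorphM -mulrBl -mulrBr.
  by apply/QR/QL/JQ.
- move=> x y Qxy; have [a xa] := fJ x; have [b yb] := fJ y.
  have [] := prQ a b.
  + move=> r; rewrite /preimage /= !rmorphM.
    (* [x * f r * y] is the sum of [(x - f a) * f r * y], [f a * f r * (y - f b)] and
       [f a * f r * f b]; the first two lie in [Q]. *)
    apply: (@left_idealDr _ _ ((x - f a) * f r * y)) => //.
      by apply/QR/QR/JQ.
    apply: (@left_idealDr _ _ (f a * f r * (y - f b))) => //.
      by apply/QL/JQ.
    by rewrite mulrBr !mulrBl addrC addrACA subrK subrr addr0.
  + by left; apply: (left_idealBr lQ (JQ _ xa)).
  + by right; apply: (left_idealBr lQ (JQ _ yb)).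
Qed.

Lemma contraction_semiprime Q : J `<=` Q ->
  semiprime_ideal Q -> semiprime_ideal (f @^-1` Q).
Proof.
move=> JQ /semiprime_idealP[iQ prQ].
have [lQ [Q0 QD QR]] := iQ; have [_ _ QL] := lQ.
apply/semiprime_idealP; split; first exact: contraction_ideal.
move=> a Qa; apply: prQ => r; have [c rc] := fJ r.
apply: (@left_idealBr _ _ _ (f (a * c * a))) => //; last exact: Qa.
rewrite !rmorphM -mulrBl -mulrBr.
by apply/QR/QL/JQ.
Qed.

Lemma extension_contraction Q X : left_ideal Q -> J `<=` Q ->
  f @^-1` Q `<=` X -> Q `<=` extension X.
Proof.
move=> lQ JQ QX b Qb; have [a ba] := fJ b; exists a => //.
apply: QX; rewrite /preimage /=; apply: (left_idealDr lQ (JQ _ ba)).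
by rewrite subrK.
Qed.

(** If [f a - f c] is in [J] with [c] in [X], then [a - c] lies in the contraction of [Q], hence in
    [X]. *)
Lemma extension_eqT Q X : left_ideal X -> J `<=` Q -> f @^-1` Q `<=` X ->
  extension X = setT -> X = setT.
Proof.
move=> lX JQ QX ET; apply/seteqP; split=> // a _.
have : extension X (f a) by rewrite ET.
move=> [c Xc]; rewrite -rmorphB => Jac.
by apply: (@left_idealBr _ _ _ c) => //; apply: QX; apply: JQ.
Qed.

Lemma contraction_maximal_left Q : J `<=` Q ->
  maximal_left_ideal Q -> maximal_left_ideal (f @^-1` Q).
Proof.
move=> JQ [lQ pQ mQ]; split; first exact: contraction_left_ideal.
  exact/(contraction_proper lQ).
move=> X lX QX.
have [EQ|ET] := mQ _ (extension_left_ideal lX) (extension_contraction lQ JQ QX).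
  left; apply/seteqP; split=> // a Xa.
  by rewrite /preimage /= -EQ; apply: extension_mem.
by right; apply: (extension_eqT lX JQ).
Qed.

Lemma contraction_maximal Q : J `<=` Q ->
  maximal_ideal Q -> maximal_ideal (f @^-1` Q).
Proof.
move=> JQ [iQ pQ mQ]; have [lQ _] := iQ.
split; first exact: contraction_ideal.
  exact/(contraction_proper lQ).
move=> X iX QX; have [lX _] := iX.
have [EQ|ET] := mQ _ (extension_ideal iX) (extension_contraction lQ JQ QX).
  left; apply/seteqP; split=> // a Xa.
  by rewrite /preimage /= -EQ; apply: extension_mem.
by right; apply: (extension_eqT lX JQ).
Qed.

End SurjectiveModulo.

(** Replaces nil ideals of the quotient ring by ideals of [A] that are nil modulo [P]. The results
    on contraction are applied to the projection onto the quotient, with [J = 0]. *)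
Lemma strongly_prime_idealP (A : pzRingType) (P : set A) :
  strongly_prime_ideal P <-> prime_ideal P /\
    forall N, ideal N -> (forall x, N x -> exists n, P (x ^+ n)) -> N `<=` P.
Proof.
have onto (iP : ideal P) (b : quot_ring iP) :
    exists a, [set 0] (b - quot_proj iP a).
  by have [a <-] := quot_proj_surj b; exists a; rewrite /= subrr.
have kerE (iP : ideal P) : @quot_proj _ P iP @^-1` [set 0] = P.
  apply/seteqP; split=> x; rewrite /preimage /=.
    by rewrite -[0](rmorph0 (quot_proj iP)) => /quot_projE; rewrite subr0.
  by move=> Px; rewrite -[0](rmorph0 (quot_proj iP)); apply/quot_projE;
    rewrite subr0.
have primeE (iP : ideal P) : prime_ring (quot_ring iP) <-> prime_ideal P.
  by have := contraction_prime (@onto iP) (ideal0 _) (fun _ => id);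
    rewrite kerE.
have zeroP (iP : ideal P) x : P x <-> quot_proj iP x = 0.
  by rewrite -{1}(kerE iP).
split=> [[iP [/primeE pP nilP]]|[pP nilP]].
  split=> // N iN nN x Nx; apply/(zeroP iP).
  (* With [J = 0] the extension of [N] is its image in the quotient ring, which is a nil ideal. *)
  have EN : extension (quot_proj iP) [set 0] N = [set 0].
    apply: nilP; first exact: (extension_ideal (ideal0 _) (@onto iP)).
    move=> b [a Na /= /subr0_eq ->]; have [n Pan] := nN _ Na; exists n.
    by rewrite -rmorphXn; apply/zeroP.
  by have := extension_mem (quot_proj iP) (ideal0 _) Nx; rewrite EN.
have [iP _ _] := pP; exists iP; split; first exact/primeE.
move=> N iN nN; apply/seteqP; split=> [b Nb|_ ->]; last by case: iN; case.
have [a ab] := quot_proj_surj b; rewrite -ab /=; apply/zeroP.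
apply: (nilP (@quot_proj _ P iP @^-1` N)).
- exact: (contraction_ideal (quot_proj iP)).
- move=> x Nx; have [n xn] := nN _ Nx; exists n.
  by apply/(zeroP iP); rewrite rmorphXn.
- by rewrite /preimage /= ab.
Qed.

(** If [N] is nil modulo the contraction, then [f N + J] is nil modulo [Q], because [J] lies in
    [Q]. *)
Lemma contraction_strongly_prime (A B : pzRingType) (f : {rmorphism A -> B})
    (J Q : set B) : ideal J -> (forall b, exists a, J (b - f a)) -> J `<=` Q ->
  strongly_prime_ideal Q -> strongly_prime_ideal (f @^-1` Q).
Proof.
move=> iJ fJ JQ /strongly_prime_idealP[pQ nilQ]; have [iQ _ _] := pQ.
apply/strongly_prime_idealP; split; first exact/(contraction_prime fJ iQ JQ).
move=> N iN nN a Na; apply: (nilQ (extension f J N)).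
- exact: (extension_ideal iJ).
- move=> b [c Nc bc]; have [n cn] := nN _ Nc; exists n.
  apply: (@left_idealBr _ _ _ (f (c ^+ n))) => //; first by case: iQ.
  by rewrite rmorphXn; apply: ideal_expr_cong => //; apply: JQ.
- exact: extension_mem.
Qed.

(** * Restriction of scalars and primitive ideals *)

Section RestrictScalars.
Variables (A B : pzRingType) (f : {rmorphism A -> B}) (M : lmodType B).

(** The morphism is an argument of the type so that the [A]-module structure on the carrier of [M]
    can be inferred from it. *)
Definition restrict_scalars of {rmorphism A -> B} : Type := M.
Local Notation fM := (restrict_scalars f).

HB.instance Definition _ := GRing.Zmodule.on fM.

Definition restrict_scale (a : A) (m : fM) : fM := f a *: (m : M).

Fact restrict_scaleA a b m :
  restrict_scale a (restrict_scale b m) = restrict_scale (a * b) m.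
Proof. by rewrite /restrict_scale scalerA rmorphM. Qed.

Fact restrict_scale1 : left_id 1 restrict_scale.
Proof. by move=> m; rewrite /restrict_scale rmorph1 scale1r. Qed.

Fact restrict_scaleDr : right_distributive restrict_scale +%R.
Proof. by move=> a u v; rewrite /restrict_scale scalerDr. Qed.

Fact restrict_scaleDl m : {morph restrict_scale^~ m : a b / a + b}.
Proof. by move=> a b; rewrite /restrict_scale rmorphD scalerDl. Qed.

HB.instance Definition _ := GRing.Zmodule_isLmodule.Build A fM
  restrict_scaleA restrict_scale1 restrict_scaleDr restrict_scaleDl.

End RestrictScalars.

(** A simple [M] is killed by [J], so [b] acts on it as any [f a] congruent to [b] modulo [J]; hence
    [A]-submodules of [M] are [B]-submodules. *)
Lemma contraction_left_primitive (A B : pzRingType) (f : {rmorphism A -> B})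
    (J Q : set B) : ideal J -> (forall b, exists a, J (b - f a)) ->
  (forall x y, J x -> J y -> x * y = 0) ->
  left_primitive_ideal Q -> left_primitive_ideal (f @^-1` Q).
Proof.
move=> [[J0 JD JL] [_ _ JR]] fJ J2 [M [[[m0 m0N0] sM] ->]].
have JM j (m : M) : J j -> j *: m = 0.
  (* The submodule of elements killed by [J] contains [J M] because [J^2 = 0]. If it is zero, then
     [J M = 0], so it is all of [M], which contradicts [m0 != 0]. *)
  pose N := [pred m : M | `[< forall j, J j -> j *: m = 0 >]].
  have cN : GRing.submod_closed N.
    split; first by apply/asboolP => i _; rewrite scaler0.
    move=> a u v /asboolP Nu /asboolP Nv; apply/asboolP => i Ji.
    by rewrite scalerDr Nv // addr0 scalerA Nu //; apply: JR.
  have [N0|NT] := sM N cN; last first.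
    have /asboolP Nm : m \in N by rewrite NT.
    exact: Nm.
  have memN n : n \in N.
    apply/asboolP => i Ji; apply/eqP.
    change (i *: n \in pred1 0); rewrite -N0; apply/asboolP => k Jk.
    by rewrite scalerA J2 // scale0r.
  by have := N0 m0; rewrite memN !inE (negPf m0N0).
exists (restrict_scalars M f); split=> //; split; first by exists m0.
move=> N [N0 cN]; apply: (sM N); split=> // b u v Nu Nv.
have [a ba] := fJ b; rewrite -[b](subrK (f a)) scalerDl JM // add0r.
exact: cN.
Qed.

(** * Passage to converse rings for right primitive ideals *)

Lemma ideal_converse (A : pzRingType) (P : set A) : ideal P -> @ideal A^c P.
Proof. by move=> [lP rP]; split. Qed.

Section ConverseMorphism.
Variables (A B : pzRingType) (f : {rmorphism A -> B}).

Definition converse_hom : A^c -> B^c := f.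

Fact converse_hom_zmod : zmod_morphism converse_hom.
Proof. exact: (rmorphB f). Qed.

Fact converse_hom_monoid : monoid_morphism converse_hom.
Proof. by split=> [|x y]; [apply: (rmorph1 f) | apply: (rmorphM f)]. Qed.

HB.instance Definition _ :=
  GRing.isZmodMorphism.Build A^c B^c converse_hom converse_hom_zmod.
HB.instance Definition _ :=
  GRing.isMonoidMorphism.Build A^c B^c converse_hom converse_hom_monoid.

End ConverseMorphism.

Lemma contraction_right_primitive (A B : pzRingType) (f : {rmorphism A -> B})
    (J Q : set B) : ideal J -> (forall b, exists a, J (b - f a)) ->
  (forall x y, J x -> J y -> x * y = 0) ->
  right_primitive_ideal Q -> right_primitive_ideal (f @^-1` Q).
Proof.
move=> iJ fJ J2.
have J2c (x y : B^c) : J x -> J y -> x * y = 0 by move=> Jx Jy; apply: J2.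
exact: (@contraction_left_primitive A^c B^c (converse_hom f) J Q
  (ideal_converse iJ) fJ J2c).
Qed.

(** * The decomposition of [T] as [R + I], and the conductors *)

Section ConductorIdeal.
Variables (T : pzRingType) (S : {pred T}) (R : subPzRingType S) (I : set T).
Hypotheses (hR : maximal_subring S) (iI : ideal I).
Hypotheses (I0 : I <> [set 0]) (SI0 : [set` S] `&` I = [set 0]).
Local Notation v := (\val : R -> T).

Lemma subring_meet0 x : x \in S -> I x -> x = 0.
Proof. by move=> Sx Ix; have : ([set` S] `&` I) x by []; rewrite SI0. Qed.

Lemma val_meet0 r : I (v r) -> r = 0.
Proof.
by move=> Ir; apply: val_inj; rewrite rmorph0; apply: subring_meet0 (valP r) Ir.
Qed.

(* [R + L] is a subring strictly larger than [R], hence all of [T]. *)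
Lemma bimodule_sum (L : set T) : L 0 -> (forall x y, L x -> L y -> L (x + y)) ->
  (forall r x, L x -> L (v r * x)) -> (forall r x, L x -> L (x * v r)) ->
  (forall x y, L x -> L y -> L (x * y)) -> (exists2 x, L x & x \notin S) ->
  forall t, exists r, L (t - v r).
Proof.
move=> L0 LD LL LR LM [x Lx nSx] t.
have LN y : L y -> L (- y).
  by move=> Ly; rewrite -mulN1r -(rmorph1 v) -rmorphN; apply: LL.
pose S' := [pred t : T | `[< exists r, L (t - v r) >]].
have [_ _ maxS] := hR.
have cS' : GRing.subring_closed S'.
  split=> [|y z /asboolP[r yr] /asboolP[s zs]|y z /asboolP[r yr] /asboolP[s zs]].
  - by apply/asboolP; exists 1; rewrite rmorph1 subrr.
  - apply/asboolP; exists (r - s).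
    have -> : y - z - v (r - s) = (y - v r) - (z - v s).
      by rewrite rmorphB !opprB ![v s + _]addrC addrACA.
    by apply: LD => //; apply: LN.
  - apply/asboolP; exists (r * s).
    have -> : y * z - v (r * s) =
        (y - v r) * (z - v s) + (y - v r) * v s + v r * (z - v s).
      by rewrite rmorphM -mulrDr subrK mulrBl mulrBr addrA subrK.
    by apply: (LD); [apply: (LD); [apply: LM|apply: LR]|apply: LL].
have SS' : {subset S <= S'}.
  move=> s Ss; apply/asboolP; exists (Sub s Ss).
  by rewrite SubK subrr.
have S'x : x \in S' by apply/asboolP; exists 0; rewrite rmorph0 subr0.
have [SE|TE] := maxS S' cS' SS'; first by rewrite SE (negPf nSx) in S'x.
by have /asboolP : t \in S' by rewrite TE.
Qed.

(** By [bimodule_sum], a nonzero [L] gives [i = l + v r] for each [i] in [I]; then [v r = i - l]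
    lies in both [S] and [I], so it vanishes and [i = l]. *)
Lemma bimodule_full (L : set T) : L `<=` I ->
  (forall x y, L x -> L y -> L (x + y)) ->
  (forall r x, L x -> L (v r * x)) -> (forall r x, L x -> L (x * v r)) ->
  (forall x y, L x -> L y -> L (x * y)) -> L 0 -> L = [set 0] \/ L = I.
Proof.
move=> LI LD LL LR LM L0; have [lI _] := iI.
have [|/existsNP[x /not_implyP[Lx nx0]]] := pselect (forall x, L x -> x = 0).
  by move=> L00; left; apply/seteqP; split=> // _ ->.
right; apply/seteqP; split=> // i Ii.
have [] := bimodule_sum L0 LD LL LR LM _ i.
  by exists x => //; apply: contra_notN nx0 => Sx; apply: subring_meet0; auto.
move=> r Lir; suff r0 : r = 0 by rewrite r0 rmorph0 subr0 in Lir.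
by apply: val_meet0; rewrite -[v r](subKr i); apply: left_idealB; auto.
Qed.

Lemma sub_meet0_ideal X : ideal X -> X `<=` I -> X = [set 0] \/ X = I.
Proof.
move=> [[X0 XD XL] [_ _ XR]] XI.
apply: bimodule_full => // [r x|r x|x y _]; auto.
Qed.

(** Applies [bimodule_sum] to [L = I], whose nonzero elements lie outside [S]. Together with
    [val_meet0] it makes [R] a copy of [T / I]. *)
Lemma sum_meet0 t : exists r, I (t - v r).
Proof.
have [[J0 JD JL] [_ _ JR]] := iI.
have [x Ix nx0] : exists2 x, I x & x <> 0.
  apply: contra_notP I0 => H; apply/seteqP; split=> [x Ix|_ ->] //=.
  by apply: contra_notP H; exists x.
apply: bimodule_sum => //; [by auto|by auto|by auto|].
by exists x => //; apply: contra_notN nx0 => Sx; apply: subring_meet0.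
Qed.

Lemma meet0_minimal : minimal_ideal I.
Proof. by split=> // X iX X0 XI; case: (sub_meet0_ideal iX XI). Qed.

Lemma meet0_maximal X :
  ideal X -> [set` S] `&` X = [set 0] -> I `<=` X -> X = I.
Proof.
move=> [lX _] SX0 IX; apply/seteqP; split=> // x Xx.
have [r Ixr] := sum_meet0 x.
have : ([set` S] `&` X) (v r).
  split; first exact: valP.
  by rewrite -[v r](subKr x); apply: left_idealB => //; apply: IX.
by rewrite SX0 => /= r0; rewrite r0 subr0 in Ixr.
Qed.

(** If [T x] lies in [S], then [I x] lies in [S] and in [I], so it is zero. Conversely, if
    [I x = 0], then [T x = R x] because [T = R + I]. *)
Lemma left_conductorE : left_conductor S = rann_in S I.
Proof.
have [_ [_ _ IR]] := iI; have [[S1 SB SM] _ _] := hR.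
apply/seteqP; split=> [x Tx|x [Sx xI] t].
  split; first by rewrite -[x]mul1r; apply: Tx.
  by move=> i Ii; apply: subring_meet0; [apply: Tx | apply: IR].
have [r Itr] := sum_meet0 t.
by rewrite -[t](subrK (v r)) mulrDl xI // add0r SM //; apply: valP.
Qed.

Lemma right_conductorE : right_conductor S = lann_in S I.
Proof.
have [[_ _ IL] _] := iI; have [[S1 SB SM] _ _] := hR.
apply/seteqP; split=> [x xT|x [Sx xI] t].
  split; first by rewrite -[x]mulr1; apply: xT.
  by move=> i Ii; apply: subring_meet0; [apply: xT | apply: IL].
have [r Itr] := sum_meet0 t.
by rewrite -[t](subrK (v r)) mulrDr xI // add0r SM //; apply: valP.
Qed.

Lemma conductor_sub : conductor S `<=` left_conductor S `&` right_conductor S.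
Proof.
by move=> x TxT; split=> t; [rewrite -[_ * _]mulr1 | rewrite -[x]mul1r];
  apply: TxT.
Qed.

(** For [s = i + v r] the term [i * x] vanishes, so [s * x * t = v r * (x * t)] is a product of two
    elements of [S]. *)
Lemma conductorI : conductor S = left_conductor S `&` right_conductor S.
Proof.
apply/seteqP; split=> [|x]; first exact: conductor_sub.
have [[S1 SB SM] _ _] := hR.
rewrite left_conductorE => -[[Sx Ix] xT] s t.
have [r Isr] := sum_meet0 s.
by rewrite -[s](subrK (v r)) mulrDl Ix // add0r -mulrA SM //; apply: valP.
Qed.

(** * Annihilators of [I] when its square is nonzero *)

Section SquareNonzero.
Hypothesis II0 : prodset I I <> [set 0].

(** The elements of [I] killed by [I] from the left form an ideal of [T] inside [I]; it is [0] or
    [I], and the second would give [I^2 = 0]. *)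
Lemma rann_meet0 x : I x -> (forall i, I i -> i * x = 0) -> x = 0.
Proof.
have [[J0 JD JL] [_ _ JR]] := iI; move=> Ix xI.
pose K : set T := [set x | I x /\ forall i, I i -> i * x = 0].
have [||K0|KI] := @sub_meet0_ideal K.
- split; split=> [|y z [Iy yI] [Iz zI]|a y [Iy yI]].
  + by split=> // i _; rewrite mulr0.
  + by split=> [|i Ii]; [auto | rewrite mulrDr yI // zI // addr0].
  + by split=> [|i Ii]; [auto | rewrite mulrA yI //; auto].
  + by split=> // i _; rewrite mulr0.
  + by split=> [|i Ii]; [auto | rewrite mulrDr yI // zI // addr0].
  + by split=> [|i Ii]; [auto | rewrite mulrA yI // mul0r].
- by move=> y [].
- by have : K x by []; rewrite K0.
- case: II0; apply/prodset_eq0 => y z Iy; rewrite -{1}KI => -[_]; exact.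
Qed.

Lemma lann_meet0 x : I x -> (forall i, I i -> x * i = 0) -> x = 0.
Proof.
have [[J0 JD JL] [_ _ JR]] := iI; move=> Ix xI.
pose K : set T := [set x | I x /\ forall i, I i -> x * i = 0].
have [||K0|KI] := @sub_meet0_ideal K.
- split; split=> [|y z [Iy yI] [Iz zI]|a y [Iy yI]].
  + by split=> // i _; rewrite mul0r.
  + by split=> [|i Ii]; [auto | rewrite mulrDl yI // zI // addr0].
  + by split=> [|i Ii]; [auto | rewrite -mulrA yI // mulr0].
  + by split=> // i _; rewrite mul0r.
  + by split=> [|i Ii]; [auto | rewrite mulrDl yI // zI // addr0].
  + by split=> [|i Ii]; [auto | rewrite -mulrA yI //; auto].
- by move=> y [].
- by have : K x by []; rewrite K0.
- by case: II0; apply/prodset_eq0 => y z; rewrite -{1}KI => -[_]; apply.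
Qed.

(** If [I t = 0], then [t * i] is an element of [I] killed by [I] from the left, hence zero; the
    converse is symmetric. *)
Lemma ann_meet0_sym t :
  (forall i, I i -> i * t = 0) <-> (forall i, I i -> t * i = 0).
Proof.
have [[J0 JD JL] [_ _ JR]] := iI; split=> tI i Ii.
  by apply: rann_meet0 => [|j Ij]; [auto | rewrite mulrA tI // mul0r].
by apply: lann_meet0 => [|j Ij]; [auto | rewrite -mulrA tI // mulr0].
Qed.

Lemma left_right_conductor : left_conductor S = right_conductor S.
Proof.
rewrite left_conductorE right_conductorE.
by apply/seteqP; split=> x [Sx /ann_meet0_sym].
Qed.

Lemma conductor_left : conductor S = left_conductor S.
Proof. by rewrite conductorI -left_right_conductor setIid. Qed.

Lemma conductor_right : conductor S = right_conductor S.
Proof. by rewrite conductor_left left_right_conductor. Qed.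

Lemma ann_meet_conductor : ann I `&` [set` S] = conductor S.
Proof.
rewrite conductor_left left_conductorE; apply/seteqP; split=> x.
  by move=> [xI Sx]; split=> // i /xI[].
move=> [Sx xI]; split=> // i Ii; split; last exact: xI.
by move: i Ii; apply/ann_meet0_sym.
Qed.

Lemma ann_ideal : ideal (ann I).
Proof.
have [[J0 JD JL] [_ _ JR]] := iI.
have ann0 : ann I 0 by move=> i _; rewrite mul0r mulr0.
have annD x y : ann I x -> ann I y -> ann I (x + y).
  move=> xI yI i Ii; have [xi ix] := xI _ Ii; have [yi iy] := yI _ Ii.
  by rewrite mulrDl mulrDr xi yi ix iy addr0.
split; split=> // a x xI i Ii.
  have [xi _] := xI _ Ii; have [_ iax] := xI _ (JR a _ Ii).
  by rewrite -mulrA xi mulr0 mulrA.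
have [_ ix] := xI _ Ii; have [xai _] := xI _ (JL a _ Ii).
by rewrite mulrA ix mul0r -mulrA.
Qed.

(** The intersection of [X] and [I] is [0] or [I], and it contains both [X I] and [I X]. *)
Lemma ideal_ann_or_full X : ideal X -> X `<=` ann I \/ I `<=` X.
Proof.
have [[J0 JD JL] [_ _ JR]] := iI; move=> [[X0 XD XL] [_ _ XR]].
have [||XI0|XII] := @sub_meet0_ideal (X `&` I).
- by split; split=> [|x y [Xx Ix] [Xy Iy]|a x [Xx Ix]]; split; auto.
- by move=> x [].
- left=> x Xx i Ii.
  have mem y : X y -> I y -> y = 0.
    by move=> Xy Iy; have : (X `&` I) y by []; rewrite XI0.
  by split; apply: mem; auto.
- by right=> i; rewrite -{1}XII => -[].
Qed.

Lemma not_meet0_sub_ann : ~ I `<=` ann I.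
Proof.
by move=> Iann; apply: II0; apply/prodset_eq0 => x y /Iann xI /xI[].
Qed.

Lemma ann_minimal_prime : minimal_prime_ideal (ann I).
Proof.
split.
  split; first exact: ann_ideal.
    by move=> annT; apply: not_meet0_sub_ann; rewrite annT.
  move=> X Y iX iY XYI.
  have [|IX] := ideal_ann_or_full iX; first by left.
  have [|IY] := ideal_ann_or_full iY; first by right.
  have [_ [_ _ JR]] := iI.
  (* Otherwise both ideals contain [I], so [I^2] lies in [X Y] and is killed by [I]; being inside
     [I], it is zero. *)
  case: II0; apply/prodset_eq0 => x y Ix Iy; apply: rann_meet0; first exact: JR.
  by move=> i Ii; have [] := XYI (x * y) (prodset_mul (IX _ Ix) (IY _ Iy)) _ Ii.
move=> X [iX _ prX] XI; apply/seteqP; split=> //.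
(* The product of [ann I] and [I] is zero, so the prime ideal [X] contains one of them; containing
   [I] would put [I] inside [ann I]. *)
have [|//|IX] := prX _ _ ann_ideal iI.
  have [[X0 XD _] _] := iX.
  by apply: prodset_sub => // x i xI /xI[->].
by case: not_meet0_sub_ann; apply: subset_trans XI.
Qed.

End SquareNonzero.

(** * Ideals of [R] multiplied by [I] or extended to [T] *)

Section SubringIdeal.
Variable A : set R.
Hypothesis iA : ideal A.
Local Notation vA := (v @` A).

Lemma ideal_image_mul r y : vA y -> vA (v r * y) /\ vA (y * v r).
Proof.
have [[_ _ AL] [_ _ AR]] := iA; move=> [a Aa <-]; rewrite -!rmorphM.
by split; [exists (r * a); auto | exists (a * r); auto].
Qed.

(** [I A] is stable under [T] on the left but a priori only under [R] on the right, so the dichotomy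
    for bimodules is used rather than the one for ideals of [T]. *)
Lemma meet0_mul_image : prodset I vA = [set 0] \/ prodset I vA = I.
Proof.
have [[J0 JD JL] [_ _ JR]] := iI.
apply: bimodule_full.
- by apply: prodset_sub => // x y Ix _; apply: JR.
- by move=> x y; apply: prodsetD.
- by move=> r x; apply: prodset_mull => y; apply: JL.
- by move=> r x; apply: prodset_mulr => y /(ideal_image_mul r)[].
- by move=> x y _; apply: prodset_mull => z; apply: JL.
- exact: prodset0.
Qed.

Lemma image_mul_meet0 : prodset vA I = [set 0] \/ prodset vA I = I.
Proof.
have [[J0 JD JL] [_ _ JR]] := iI.
apply: bimodule_full.
- by apply: prodset_sub => // x y _ Iy; apply: JL.
- by move=> x y; apply: prodsetD.
- by move=> r x; apply: prodset_mull => y /(ideal_image_mul r)[].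
- by move=> r x; apply: prodset_mulr => y; apply: JR.
- by move=> x y Lx _; apply: prodset_mulr Lx => z; apply: JR.
- exact: prodset0.
Qed.

(** If [I A] or [A I] is zero, then [A] annihilates [I] on both sides and so lies in the
    conductor. *)
Lemma image_conductor_or_full : prodset I I <> [set 0] ->
  vA `<=` conductor S \/ prodset I vA = I /\ prodset vA I = I.
Proof.
move=> II0.
have conductorE x : vA x -> (forall i, I i -> i * x = 0) -> conductor S x.
  rewrite (conductor_left II0) left_conductorE.
  by move=> [a _ <-] aI; split=> //; apply: valP.
have [/prodset_eq0 IA0|IA] := meet0_mul_image.
  by left=> x Ax; apply: conductorE => // i Ii; apply: IA0.
have [/prodset_eq0 AI0|AI] := image_mul_meet0; last by right.
left=> x Ax; apply: conductorE => //; apply/(ann_meet0_sym II0) => i.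
exact: AI0.
Qed.

(** Since [T = R + I], the product [A T] lies in [A + I], and [T A] contains both [A] and [I = I A];
    the other inclusion is symmetric. *)
Lemma image_mulT_comm : prodset I vA = I -> prodset vA I = I ->
  prodset vA setT = prodset setT vA.
Proof.
have [[J0 JD JL] [_ _ JR]] := iI; move=> IA AI.
apply/seteqP; split; apply: prodset_sub; try exact: prodset0;
  try exact: prodsetD.
- move=> x y Ax _; have [r Iyr] := sum_meet0 y.
  rewrite -[y](subrK (v r)) mulrDr; apply: prodsetD; last first.
    by rewrite -[_ * _]mul1r; apply: prodset_mul => //;
      have [] := ideal_image_mul r Ax.
  have : I (x * (y - v r)) by apply: JL.
  rewrite -{1}IA; apply: prodset_sub; first exact: prodset0.
    exact: prodsetD.
  by move=> u w _ Aw; apply: prodset_mul.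
- move=> x y _ Ay; have [r Ixr] := sum_meet0 x.
  rewrite -[x](subrK (v r)) mulrDl; apply: prodsetD; last first.
    by rewrite -[_ * _]mulr1; apply: prodset_mul => //;
      have [] := ideal_image_mul r Ay.
  have : I ((x - v r) * y) by apply: JR.
  rewrite -{1}AI; apply: prodset_sub; first exact: prodset0.
    exact: prodsetD.
  by move=> u w Au _; apply: prodset_mul.
Qed.

End SubringIdeal.

(** [T A] lies in [A + I], and an element of [S] congruent modulo [I] to an element of [A] equals
    it, since [S] meets [I] only in [0]. *)
Lemma extended_left_ideal (A : set R) : left_ideal A ->
  prodset setT (v @` A) `&` [set` S] = v @` A.
Proof.
have [[J0 JD JL] [_ _ JR]] := iI;
move=> [A0 AD AL]; apply/seteqP; split=> [x [TAx Sx]|_ [a Aa <-]]; last first.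
  split; last exact: valP.
  by rewrite -[X in prodset _ _ X]mul1r; apply: prodset_mul => //; exists a.
have [a Aa Ixa] : extension v I A x.
  have [E0 ED EL] := extension_left_ideal iI sum_meet0 (And3 A0 AD AL).
  move: TAx; apply: prodset_sub => // t _ _ [a Aa <-].
  by apply: EL; apply: extension_mem.
exists a => //; apply/esym/subr0_eq/subring_meet0 => //.
have [[_ SB _] _ _] := hR; apply: SB => //; exact: valP.
Qed.

Lemma extended_right_ideal (A : set R) : right_ideal A ->
  prodset (v @` A) setT `&` [set` S] = v @` A.
Proof.
have [[J0 JD JL] [_ _ JR]] := iI;
move=> [A0 AD AR]; apply/seteqP; split=> [x [TAx Sx]|_ [a Aa <-]]; last first.
  split; last exact: valP.
  by rewrite -[X in prodset _ _ X]mulr1; apply: prodset_mul => //; exists a.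
(* [A T] lies in [A + I], because [A R] lies in [A] and [A I] in [I]. *)
have [a Aa Ixa] : extension v I A x.
  move: TAx; apply: prodset_sub.
  - by exists 0; rewrite // rmorph0 subr0.
  - move=> y z [a Aa ya] [b Ab zb]; exists (a + b); first exact: AD.
    by rewrite rmorphD opprD addrACA; apply: JD.
  - move=> _ t [a Aa <-] _; have [r Itr] := sum_meet0 t.
    by exists (a * r); [apply: AR | rewrite rmorphM -mulrBr; apply: JL].
exists a => //; apply/esym/subr0_eq/subring_meet0 => //.
have [[_ SB _] _ _] := hR; apply: SB => //; exact: valP.
Qed.

(** * Transfer of semiprimeness between [T] and [R] *)

Lemma square_nonzero_of_semiprime : semiprime_ring T -> prodset I I <> [set 0].
Proof.
move=> [_ spT] II0; apply: I0; apply/seteqP; split; last first.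
  by move=> _ ->; case: iI; case.
by apply: spT => //; rewrite II0.
Qed.

(** An ideal [A] of [R] with square zero cannot satisfy [A I = I], so it lies in the conductor and
    annihilates [I]; then [a T a = a R a = 0] for [a] in [A]. *)
Lemma semiprime_subring : semiprime_ring T -> semiprime_ring R.
Proof.
move=> spT; have II0 := square_nonzero_of_semiprime spT.
split; first exact: ideal0.
move=> A iA AA0 a Aa; have [[A0 AD AL] [_ _ AR]] := iA.
have {}AA0 x y : A x -> A y -> x * y = 0.
  by move=> Ax Ay; apply: AA0; apply: prodset_mul.
have [Ac|[_ AI]] := image_conductor_or_full iA II0; last first.
  (* Each [x] in [A] kills [A I = I] because [x A = 0], so [A I = 0]. *)
  case: II0; suff AI0 : prodset (v @` A) I = [set 0].
    by rewrite -{1}AI AI0; apply/prodset_eq0 => _ y ->; rewrite mul0r.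
  apply/prodset_eq0 => _ i [x Ax <-]; rewrite -{1}AI => Ai.
  have : prodset (v @` A) I `<=` [set z | v x * z = 0].
    apply: prodset_sub => /=; first exact: mulr0.
      by move=> y z y0 z0; rewrite mulrDr y0 z0 addr0.
    by move=> _ z [y Ay <-] _; rewrite mulrA -rmorphM AA0 // rmorph0 mul0r.
  exact.
have aI0 : (forall i, I i -> i * v a = 0).
  have : conductor S (v a) by apply: Ac; exists a.
  by rewrite (conductor_left II0) left_conductorE => -[].
have Ia0 : (forall i, I i -> v a * i = 0) by apply/ann_meet0_sym.
apply: val_inj; rewrite rmorph0.
have /semiprime_idealP[_ elT] := spT; apply: elT => t.
have [r Itr] := sum_meet0 t; rewrite -[t](subrK (v r)) mulrDr mulrDl Ia0 //.
by rewrite mul0r add0r -!rmorphM AA0 ?rmorph0 //; apply: AR.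
Qed.

(** The projection [A] to [R] along [I] of a square-zero ideal [X] is a square-zero ideal, hence
    zero. So [X] lies in [I] and is [0] or [I]; the latter is excluded by [I^2 <> 0]. *)
Lemma semiprime_of_subring :
  semiprime_ring R -> prodset I I <> [set 0] -> semiprime_ring T.
Proof.
move=> [_ spR] II0; split; first exact: ideal0.
move=> X iX XX0; have [[X0 XD XL] [_ _ XR]] := iX.
have [[J0 JD JL] [_ _ JR]] := iI; have [lI _] := iI.
pose A : set R := [set a | exists2 x, X x & I (x - v a)].
have iA : ideal A.
  have A0 : A 0 by exists 0 => //; rewrite rmorph0 subr0.
  have AD x y : A x -> A y -> A (x + y).
    move=> [z Xz zx] [w Xw wy]; exists (z + w); first exact: XD.
    by rewrite rmorphD opprD addrACA; apply: JD.
  split; split=> // r x [z Xz zx].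
    by exists (v r * z); [apply: XL | rewrite rmorphM -mulrBr; apply: JL].
  by exists (z * v r); [apply: XR | rewrite rmorphM -mulrBl; apply: JR].
have AA0 : prodset A A `<=` [set 0].
  apply: prodset_sub => // [_ _ -> ->|a b [x Xx xa] [y Xy yb]].
    exact: addr0.
  apply: val_meet0; rewrite rmorphM.
  (* Here [x * y = 0] is split as [(x - v a) * y + v a * (y - v b) + v a * v b], whose first two
     terms lie in [I]. *)
  apply: (@left_idealDr _ _ (v a * (y - v b))) => //; first exact: JL.
  apply: (@left_idealDr _ _ ((x - v a) * y)) => //; first exact: JR.
  rewrite -mulrDr subrK -mulrDl subrK.
  by rewrite (XX0 (x * y)) //; apply: prodset_mul.
have XI : X `<=` I.
  move=> x Xx; have [r Ixr] := sum_meet0 x.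
  have r0 : r = 0 by apply: (spR A iA AA0); exists x.
  by rewrite r0 rmorph0 subr0 in Ixr.
have [->//|XE] := sub_meet0_ideal iX XI.
case: II0; rewrite -XE; apply/prodset_eq0 => x y Xx Xy.
by apply: XX0; apply: prodset_mul.
Qed.

(** * Radicals and units when [I] has square zero *)

Section SquareZero.
Hypothesis II0 : forall x y, I x -> I y -> x * y = 0.

(** Every maximal left ideal of [T] contains [I], so its contraction is a maximal left ideal of [R].
    Prime ideals give the lower nilradical in the same way. *)
Lemma jacobson_radical_sub :
  v @` @jacobson_radical R `<=` @jacobson_radical T `&` [set` S].
Proof.
move=> _ [a Ja <-]; split; last exact: valP.
move=> L mL; apply: (Ja (v @^-1` L)).
have IL : I `<=` L by apply: square_zero_sub_maximal_left.
exact: (contraction_maximal_left iI sum_meet0 IL mL).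
Qed.

Lemma lower_nilradical_sub :
  v @` @lower_nilradical R `<=` @lower_nilradical T `&` [set` S].
Proof.
move=> _ [a Na <-]; split; last exact: valP.
move=> P pP; apply: (Na (v @^-1` P)); have [iP _ _] := pP.
have IP : I `<=` P.
  by apply: square_zero_sub_semiprime => //; apply: prime_semiprime_ideal.
exact/(contraction_prime sum_meet0 iP IP).
Qed.

Lemma upper_nilradical_sub :
  v @` @upper_nilradical R `<=` @upper_nilradical T `&` [set` S].
Proof.
move=> _ [a [N [iN nN Na]] <-]; split; last exact: valP.
exists (extension v I N); split; last exact: extension_mem.
  exact: (extension_ideal iI sum_meet0).
(* [t ^+ n] is congruent to [v b ^+ n = 0] modulo [I], so it lies in [I] and one further squaring
   kills it. *)
move=> t [b Nb Itb]; have [n bn0] := nN _ Nb; exists (n * 2)%N.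
have := ideal_expr_cong n iI Itb.
by rewrite -rmorphXn bn0 rmorph0 subr0 exprM expr2 => It; apply: II0.
Qed.

Lemma unit_setE :
  @unit_set T = [set v u + i | u in @unit_set R & i in I].
Proof.
have [[J0 JD JL] [_ _ JR]] := iI;
apply/seteqP; split=> [x [y [xy yx]]|_ [u [w [uw wu]] [i Ii <-]]].
  have [r Ixr] := sum_meet0 x; have [s Iys] := sum_meet0 y.
  (* Elements of [R] congruent modulo [I] are equal, so inverses in [T] project to inverses in
     [R]. *)
  have inv a b a' b' : I (a - v a') -> I (b - v b') -> a * b = 1 -> a' * b' = 1.
    move=> Ia Ib ab; apply/esym/subr0_eq/val_meet0.
    rewrite rmorphB rmorph1 rmorphM -ab.
    have -> : a * b - v a' * v b' = (a - v a') * b + v a' * (b - v b').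
      by rewrite mulrBl mulrBr addrA subrK.
    by apply: JD; [apply: JR | apply: JL].
  exists r; first by exists s; split; [apply: inv xy | apply: inv yx].
  by exists (x - v r); rewrite // addrC subrK.
have vuw : v u * v w = 1 by rewrite -rmorphM uw rmorph1.
have vwu : v w * v u = 1 by rewrite -rmorphM wu rmorph1.
have iwi0 : i * v w * i = 0 by rewrite -mulrA II0 //; apply: JL.
(* The geometric expansion of the inverse of [v u + i], cut after the term linear in [i]; it is
   exact because [i * v w * i = 0]. *)
exists (v w - v w * i * v w); split.
  by rewrite mulrDl !mulrBr vuw !mulrA vuw mul1r iwi0 mul0r subr0 subrK.
rewrite mulrBl !mulrDr vwu -!mulrA vwu mulr1 (mulrA i) iwi0 mulr0 addr0.
exact: addrK.
Qed.

End SquareZero.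

End ConductorIdeal.


Theorem theorem2p1 (T : pzRingType) (S : {pred T}) (R : subPzRingType S)
    (hR : maximal_subring S) (I : set T) (hI : ideal I)
    (hI0 : I <> [set 0]) (hRI : [set` S] `&` I = [set 0]) :
  (* (1) *)
  (minimal_ideal I /\
   forall X : set T, ideal X -> [set` S] `&` X = [set 0] -> I `<=` X -> X = I)
  /\
  (* (2) *)
  (left_conductor S = rann_in S I /\ right_conductor S = lann_in S I)
  /\
  (* (3) *)
  ((prodset I I <> [set 0] ->
      conductor S = left_conductor S /\ conductor S = right_conductor S) /\
   (semiprime_ring T ->
      prodset I I <> [set 0] /\
      conductor S = left_conductor S /\ conductor S = right_conductor S))
  /\
  (* (4) *)
  ((semiprime_ring T <-> semiprime_ring R /\ prodset I I <> [set 0]) /\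
   (semiprime_ring T ->
      [/\ minimal_prime_ideal (ann I),
          ann I `&` [set` S] = conductor S,
          conductor S = left_conductor S
        & conductor S = right_conductor S]))
  /\
  (* (5) *)
  (prodset I I = [set 0] ->
    (forall Q : set T,
       [/\ prime_ideal Q -> prime_ideal ((\val : R -> T) @^-1` Q),
           semiprime_ideal Q -> semiprime_ideal ((\val : R -> T) @^-1` Q),
           maximal_ideal Q -> maximal_ideal ((\val : R -> T) @^-1` Q)
         & [/\ left_primitive_ideal Q ->
                 left_primitive_ideal ((\val : R -> T) @^-1` Q),
               right_primitive_ideal Q ->
                 right_primitive_ideal ((\val : R -> T) @^-1` Q)
             & strongly_prime_ideal Q ->
                 strongly_prime_ideal ((\val : R -> T) @^-1` Q)]])
    /\
    [/\ (\val : R -> T) @` @jacobson_radical R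
          `<=` @jacobson_radical T `&` [set` S],
        (\val : R -> T) @` @lower_nilradical R
          `<=` @lower_nilradical T `&` [set` S],
        (\val : R -> T) @` @upper_nilradical R
          `<=` @upper_nilradical T `&` [set` S]
      & @unit_set T =
          [set (\val : R -> T) u + i | u in @unit_set R & i in I]])
  /\
  (* (6) *)
  ((forall A : set R, left_ideal A ->
      prodset setT ((\val : R -> T) @` A) `&` [set` S]
        = (\val : R -> T) @` A) /\
   (forall A : set R, right_ideal A ->
      prodset ((\val : R -> T) @` A) setT `&` [set` S]
        = (\val : R -> T) @` A))
  /\
  (* (7) *)
  (prodset I I = I ->
    forall A : set R, ideal A ->
      (\val : R -> T) @` A `<=` conductor S \/
      [/\ prodset I ((\val : R -> T) @` A) = I,
          prodset ((\val : R -> T) @` A) I = I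
        & prodset ((\val : R -> T) @` A) setT
            = prodset setT ((\val : R -> T) @` A)]).
Proof.
split; first by split; [exact: (meet0_minimal R) | exact: (meet0_maximal R)].
split.
  by split; [exact: (left_conductorE R) | exact: (right_conductorE R)].
have cond : prodset I I <> [set 0] ->
    conductor S = left_conductor S /\ conductor S = right_conductor S.
  by move=> II0; split; [exact: (conductor_left R hR hI) |
    exact: (conductor_right R hR hI)].
split.
  split=> // spT; have II0 := square_nonzero_of_semiprime hI hI0 spT.
  by split=> //; apply: cond.
split.
  split.
    split=> [spT|[spR II0]]; last exact: semiprime_of_subring spR II0.
    split; first exact: (semiprime_subring R hR hI hI0 hRI spT).
    exact: square_nonzero_of_semiprime hI hI0 spT.
  move=> spT; have II0 := square_nonzero_of_semiprime hI hI0 spT.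
  have [cl cr] := cond II0; split=> //.
    exact: (ann_minimal_prime R hR hI).
  exact: (ann_meet_conductor R hR hI).
split.
  move=> /prodset_eq0 II0.
  (* The contraction lemmas are applied to the inclusion of [R] in [T], with [J = I]. *)
  have sum := sum_meet0 R hR hI hI0 hRI.
  split=> [Q|]; first split.
  - move=> pQ; have [iQ _ _] := pQ.
    have IQ : I `<=` Q.
      by apply: square_zero_sub_semiprime => //; apply: prime_semiprime_ideal.
    exact/(contraction_prime sum iQ IQ).
  - move=> sQ; apply: (contraction_semiprime sum) => //.
    exact: (square_zero_sub_semiprime hI II0 sQ).
  - move=> mQ; apply: (contraction_maximal hI sum) => //.
    exact: (square_zero_sub_maximal hI II0 mQ).
  - split.
    + exact: (contraction_left_primitive hI sum).
    + exact: (contraction_right_primitive hI sum).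
    + move=> sQ; apply: (contraction_strongly_prime hI sum) => //.
      move/strongly_prime_idealP: sQ => [pQ _].
      by apply: square_zero_sub_semiprime => //; apply: prime_semiprime_ideal.
  - split.
    + exact: (jacobson_radical_sub hR hI hI0 hRI II0).
    + exact: (lower_nilradical_sub hR hI hI0 hRI II0).
    + exact: (upper_nilradical_sub hR hI hI0 hRI II0).
    + exact: (unit_setE R hR hI hI0 hRI II0).
split; first by split=> A iA; [exact: (extended_left_ideal hR hI hI0 hRI iA) |
  exact: (extended_right_ideal hR hI hI0 hRI iA)].
move=> II A iA; have II0 : prodset I I <> [set 0] by rewrite II.
have [|[IA AI]] := image_conductor_or_full hR hI hI0 hRI iA II0; first by left.
by right; split=> //; apply: (image_mulT_comm hR hI hI0 hRI iA IA AI).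
Qed.
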